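(* Let $A$ be a $C^*$-algebra, $H$ a Hilbert $A$-module, and let $P,Q\in\mathcal{L}(H)$ be two harmonious projections. Let $P_5,P_6,H_5,H_6$ be the projections and submodules associated with $(P,Q)$ as defined in the context. Then $$\overline{\mathcal{R}(P_5Q)}=H_5,\quad\overline{\mathcal{R}(QP_5)}=\overline{\mathcal{R}\big(QP(I-Q)\big)},$$ $$\overline{\mathcal{R}(P_6Q)}=H_6,\quad\overline{\mathcal{R}(QP_6)}=\overline{\mathcal{R}\big(QP(I-Q)\big)}.$$
   Context: $\mathcal{L}(H)$ is the $C^*$-algebra of adjointable operators on the Hilbert $A$-module $H$; a projection is $P\in\mathcal{L}(H)$ with $P=P^2=P^*$; $\mathcal{R}$ and $\mathcal{N}$ denote range and null space. A closed submodule $M\subseteq H$ is orthogonally complemented in $H$ if $H=M+M^\perp$, where $M^\perp=\{x\in H:\langle x,y\rangle=0\ \forall y\in M\}$; then $P_M$ denotes the projection in $\mathcal{L}(H)$ with range $M$. Two projections $P,Q\in\mathcal{L}(H)$ are harmonious if $\overline{\mathcal{R}(P+Q)}$, $\overline{\mathcal{R}(P+I-Q)}$, $\overline{\mathcal{R}(I-P+Q)}$, $\overline{\mathcal{R}(I-P+I-Q)}$ are all orthogonally complemented in $H$. For harmonious $P,Q$ set $H_1=\mathcal{R}(P)\cap\mathcal{R}(Q)$, $H_2=\mathcal{R}(P)\cap\mathcal{N}(Q)$, $H_3=\mathcal{N}(P)\cap\mathcal{R}(Q)$, $H_4=\mathcal{N}(P)\cap\mathcal{N}(Q)$ (these are the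 orthogonal complements of the four closures above, hence orthogonally complemented in $H$), $P_i=P_{H_i}$ for $i=1,2,3,4$, and $P_5=P-P_1-P_2$, $H_5=\mathcal{R}(P_5)$, $P_6=(I-P)-P_3-P_4$, $H_6=\mathcal{R}(P_6)$; $P_5$ and $P_6$ are projections. *)

(* Defs.v *)
From HB Require Import structures.
From mathcomp Require Import all_boot all_order all_algebra.
From mathcomp Require Import complex.
From mathcomp Require Import all_classical all_reals topology normedtype.

Set Implicit Arguments.
Unset Strict Implicit.
Unset Printing Implicit Defensive.

Import Order.TTheory GRing.Theory Num.Theory.
Import numFieldNormedType.Exports.

Local Open Scope classical_set_scope.
Local Open Scope ring_scope.

(* The ring structures of MathComp are unital, whereas a C*-algebra need not
   have a unit: the product is therefore an operation of its own on a complex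
   Banach space. *)
HB.mixin Record Banach_isCStarAlgebra (R : realType) A
    of CompleteNormedModule R[i] A := {
  amul : A -> A -> A ;
  astar : A -> A ;
  amulA : forall a b c, amul a (amul b c) = amul (amul a b) c ;
  amulDl : forall a b c, amul (a + b) c = amul a c + amul b c ;
  amulDr : forall a b c, amul a (b + c) = amul a b + amul a c ;
  amulZl : forall (k : R[i]) a b, amul (k *: a) b = k *: amul a b ;
  amulZr : forall (k : R[i]) a b, amul a (k *: b) = k *: amul a b ;
  astarK : forall a, astar (astar a) = a ;
  astarD : forall a b, astar (a + b) = astar a + astar b ;
  astarZ : forall (k : R[i]) a, astar (k *: a) = k^* *: astar a ;
  astarM : forall a b, astar (amul a b) = amul (astar b) (astar a) ;
  norm_amul_le : forall a b, `|amul a b| <= `|a| * `|b| ;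
  norm_amul_star : forall a, `|amul (astar a) a| = `|a| ^+ 2
}.

#[short(type="cstarAlgType")]
HB.structure Definition CStarAlgebra (R : realType) :=
  { A of CompleteNormedModule R[i] A & Banach_isCStarAlgebra R A }.

Definition apositive (R : realType) (A : cstarAlgType R) (a : A) : Prop :=
  exists b : A, a = amul (astar b) b.

(* Right modules, with inner product conjugate-linear in the first variable
   and linear in the second.  The Banach space structure is that of the norm
   |<x, x>|^(1/2), by the axiom [hnormE]. *)
HB.mixin Record Banach_isHilbertModule (R : realType) (A : cstarAlgType R) H
    of CompleteNormedModule R[i] H := {
  ract : H -> A -> H ;
  iprod : H -> H -> A ;
  ractDl : forall x y a, ract (x + y) a = ract x a + ract y a ;
  ractDr : forall x a b, ract x (a + b) = ract x a + ract x b ;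
  ractA : forall x a b, ract x (amul a b) = ract (ract x a) b ;
  ractZl : forall (k : R[i]) x a, ract (k *: x) a = k *: ract x a ;
  ractZr : forall (k : R[i]) x a, ract x (k *: a) = k *: ract x a ;
  iprodDr : forall x y z, iprod x (y + z) = iprod x y + iprod x z ;
  iprodZr : forall (k : R[i]) x y, iprod x (k *: y) = k *: iprod x y ;
  iprod_ract : forall x y a, iprod x (ract y a) = amul (iprod x y) a ;
  iprod_star : forall x y, astar (iprod x y) = iprod y x ;
  iprod_ge0 : forall x, apositive (iprod x x) ;
  iprod_eq0 : forall x, iprod x x = 0 -> x = 0 ;
  hnormE : forall x, `|x| ^+ 2 = `|iprod x x|
}.

#[short(type="hilbertModType")]
HB.structure Definition HilbertModule (R : realType) (A : cstarAlgType R) :=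
  { H of CompleteNormedModule R[i] H & Banach_isHilbertModule R A H }.

Section Operators.
Variables (R : realType) (A : cstarAlgType R) (H : hilbertModType A).
Implicit Types (M : set H) (P Q S T : H -> H).

Definition inner (x y : H) : A := iprod x y.

Definition is_adjoint T S : Prop :=
  forall x y : H, inner (T x) y = inner x (S y).

(* No linearity or boundedness is required: both are automatic. *)
Definition adjointable T : Prop := exists S, is_adjoint T S.

Definition projection P : Prop :=
  [/\ adjointable P, P \o P = P & is_adjoint P P].

Definition nullspace T : set H := T @^-1` [set 0].

Definition orthogonal M : set H := [set x | forall y, M y -> inner x y = 0].

(* Used only for closed submodules [M]. *)
Definition orthocomplemented M : Prop :=
  forall x : H, exists y z : H, [/\ M y, orthogonal M z & x = y + z].

(* The projection with range [M], which exists and is unique when [M] is an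
   orthogonally complemented closed submodule; the default 0 is irrelevant
   otherwise. *)
Definition proj_onto M : H -> H :=
  xget (0 : H -> H) [set P : H -> H | projection P /\ range P = M].

Definition harmonious P Q : Prop :=
  [/\ orthocomplemented (closure (range (P + Q))),
      orthocomplemented (closure (range (P + idfun - Q))),
      orthocomplemented (closure (range (idfun - P + Q))) &
      orthocomplemented (closure (range (idfun - P + idfun - Q)))].

Section Pieces.
Variables P Q : H -> H.

Definition H1 : set H := range P `&` range Q.
Definition H2 : set H := range P `&` nullspace Q.
Definition H3 : set H := nullspace P `&` range Q.
Definition H4 : set H := nullspace P `&` nullspace Q.

Definition P1 : H -> H := proj_onto H1.
Definition P2 : H -> H := proj_onto H2.
Definition P3 : H -> H := proj_onto H3.
Definition P4 : H -> H := proj_onto H4.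

Definition P5 : H -> H := P - P1 - P2.
Definition P6 : H -> H := idfun - P - P3 - P4.

Definition H5 : set H := range P5.
Definition H6 : set H := range P6.

End Pieces.
End Operators.

(* Main.v *)
(* Projections are self-adjoint, and for projections a, b the null space of a + b
   is N(a) /\ N(b); so harmony says that H splits as the closed range of each of
   the four sums plus the corresponding H_i.  As P5 vanishes on R(I-P), and
   R(P5) is orthogonal to H2, hence inside the closure of R((I-P) + Q), each
   P5 y is a limit of P5 Q z_n.  Likewise R(P5) is orthogonal to H1, so each
   Q P5 y is a limit of Q P5 (I-Q) z_n = Q P (I-Q) z_n.  The statements on P6 are
   those on P5 for the pair (I-P, Q), since Q (I-P) (I-Q) = - Q P (I-Q). *)
Require Import Defs.
From HB Require Import structures.
From mathcomp Require Import all_boot all_order all_algebra.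
From mathcomp Require Import complex.
From mathcomp Require Import all_classical all_reals topology normedtype.

Set Implicit Arguments.
Unset Strict Implicit.
Unset Printing Implicit Defensive.

Import Order.TTheory GRing.Theory Num.Theory.
Import numFieldNormedType.Exports.

Local Open Scope classical_set_scope.
Local Open Scope ring_scope.

(** * Continuity and closures *)

Lemma bounded_additive_continuous (K : numFieldType) (V W : normedModType K)
    (f : V -> W) (k : K) :
  {morph f : x y / x - y} -> 0 < k -> (forall x, `|f x| <= k * `|x|) ->
  continuous f.
Proof.
move=> fB k0 fk x; apply/cvgrPdist_lt => e e0; near=> y.
rewrite -fB (le_lt_trans (fk _))// mulrC -ltr_pdivlMr//.
by near: y; apply: cvgr_dist_lt => //; exact: divr_gt0.
Unshelve. all: by end_near. Qed.

(** The preimage of [closure B] is closed and contains [A]. This carries approximations through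
    [f]. *)
Lemma closure_sub_preimage (T U : topologicalType) (f : T -> U) (A : set T)
    (B : set U) :
  continuous f -> A `<=` f @^-1` B -> closure A `<=` f @^-1` (closure B).
Proof.
move=> cf AB; rewrite [X in X `<=` _]closureE; apply: smallest_sub.
  by apply: preimage_closed; [|exact: closed_closure].
by move=> x /AB /= fx; exact/subset_closure.
Qed.

Lemma closed_preimage0 (K : numFieldType) (V W : normedModType K) (f : V -> W) :
  continuous f -> closed (f @^-1` [set 0]).
Proof.
move=> cf; apply: preimage_closed; first by move=> x _; exact: cf.
by apply: accessible_closed_set1; exact: hausdorff_accessible.
Qed.

(** * Sesquilinearity, polarization and continuity of the inner product *)

Section InnerProduct.
Variables (R : realType) (A : cstarAlgType R) (H : hilbertModType A).
Implicit Types (x y z : H) (k : R[i]).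

Lemma innerDl x y z : inner (x + y) z = inner x z + inner y z.
Proof. by rewrite /inner -!(iprod_star z) iprodDr astarD. Qed.

Lemma innerZl k x y : inner (k *: x) y = k^* *: inner x y.
Proof. by rewrite /inner -!(iprod_star y) iprodZr astarZ. Qed.

Lemma innerNl x y : inner (- x) y = - inner x y.
Proof. by rewrite -scaleN1r innerZl rmorphN1 scaleN1r. Qed.

Lemma innerBl x y z : inner (x - y) z = inner x z - inner y z.
Proof. by rewrite innerDl innerNl. Qed.

Lemma innerDr x y z : inner x (y + z) = inner x y + inner x z.
Proof. exact: iprodDr. Qed.

Lemma innerZr k x y : inner x (k *: y) = k *: inner x y.
Proof. exact: iprodZr. Qed.

Lemma innerNr x y : inner x (- y) = - inner x y.
Proof. by rewrite -scaleN1r innerZr scaleN1r. Qed.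

Lemma innerBr x y z : inner x (y - z) = inner x y - inner x z.
Proof. by rewrite innerDr innerNr. Qed.

Lemma inner0l x : inner 0 x = 0.
Proof. by rewrite -(subrr x) innerBl subrr. Qed.

Lemma inner0r x : inner x 0 = 0.
Proof. by rewrite -(subrr x) innerBr subrr. Qed.

Lemma inner_eq0_sym x y : inner x y = 0 -> inner y x = 0.
Proof.
move=> xy0; rewrite /inner -iprod_star -/(inner x y) xy0.
by rewrite -(inner0l 0) /inner iprod_star.
Qed.

(** Operator identities are proved below by pairing with an arbitrary [z] and passing to
    adjoints. *)
Lemma inner_inj x y : (forall z, inner x z = inner y z) -> x = y.
Proof.
move=> xy; apply/eqP; rewrite -subr_eq0; apply/eqP; apply: iprod_eq0.
by rewrite -/(inner _ _) innerBl xy subrr.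
Qed.

Lemma inner_polarization x y :
  4%:R *: inner x y =
  (inner (x + y) (x + y) - inner (x - y) (x - y))
  - 'i *: (inner (x + 'i *: y) (x + 'i *: y)
           - inner (x - 'i *: y) (x - 'i *: y)).
Proof.
(* Only cross terms survive. For [v = 'i *: y] the factor [- 'i] turns them into
   [(inner x y - inner y x) *+ 2], so that [inner y x] cancels. *)
have e (u v : H) : inner (u + v) (u + v) - inner (u - v) (u - v) =
    (inner u v + inner v u) *+ 2.
  have eD (w : H) : inner (u + w) (u + w) =
      (inner u u + inner w w) + (inner u w + inner w u).
    by rewrite innerDl !innerDr [X in _ + X]addrC addrACA.
  by rewrite !eD !innerNl !innerNr opprK -opprD opprB addrC addrA subrK.
rewrite !e innerZl conjCi innerZr scaleNr -scalerBr.
rewrite -scalerMnr scalerA -expr2 sqrCi scaleN1r -mulNrn opprK.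
rewrite -mulrnDl addrACA subrr addr0 -mulr2n -mulrnA.
by rewrite scaler_nat.
Qed.

Lemma inner_bound x y : `|inner x y| <= (`|x| + `|y|) ^+ 2.
Proof.
have b4 : `|4%:R *: inner x y| <= 4%:R * (`|x| + `|y|) ^+ 2.
  (* Each polarization term is [inner u u] with [u = x + v] and [v] of the same norm as [y]. *)
  have sq (u v : H) : `|v| = `|y| -> u = x + v ->
      `|inner u u| <= (`|x| + `|y|) ^+ 2.
    move=> vy ->; rewrite -hnormE ler_pXn2r ?nnegrE ?addr_ge0//.
    by rewrite -vy ler_normD.
  have ni (u : H) : `|'i *: u| = `|u| by rewrite normrZ normCi mul1r.
  have nia (u : A) : `|'i *: u| = `|u| by rewrite normrZ normCi mul1r.
  rewrite inner_polarization.
  rewrite (_ : 4%:R = (1 + 1) + (1 + 1)); last by rewrite -!mulr2n -mulrnA.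
  rewrite !mulrDl !mul1r.
  apply: le_trans (ler_normB _ _) _.
  rewrite nia; apply: lerD.
    apply: le_trans (ler_normB _ _) _; apply: lerD; first exact: (sq _ y).
    by apply: (sq _ (- y)) => //; rewrite normrN.
  apply: le_trans (ler_normB _ _) _; apply: lerD.
    by apply: (sq _ ('i *: y)).
  by apply: (sq _ (- ('i *: y))) => //; rewrite normrN ni.
by move: b4; rewrite normrZ normr_nat ler_pM2l.
Qed.

(* The constant 4 is not optimal, but this version needs no positivity in [A]:
   polarization bounds <x, y> by (|x| + |y|)^2, and rescaling y makes the two
   norms equal. *)
Lemma inner_norm_le x y : `|inner x y| <= 4%:R * `|x| * `|y|.
Proof.
have [->|y0] := eqVneq y 0; first by rewrite inner0r !normr0 mulr0.
have [->|x0] := eqVneq x 0; first by rewrite inner0l !normr0 mulr0 mul0r.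
have nx : 0 < `|x| by rewrite normr_gt0.
have ny : 0 < `|y| by rewrite normr_gt0.
have := inner_bound x ((`|x| / `|y|) *: y).
rewrite innerZr (normrZ _ (inner x y)) (normrZ _ y) ger0_norm ?divr_ge0//.
rewrite divfK ?gt_eqF// -mulr2n exprMn_n mulrAC ler_pdivrMr//.
by rewrite mulr_natl expr2 -mulrnAr -mulrA ler_pM2l.
Qed.

Lemma continuous_inner x : continuous (inner x).
Proof.
(* The summand 1 keeps the constant positive when [x = 0]. *)
apply: (@bounded_additive_continuous _ _ _ _ (4%:R * `|x| + 1)).
- by move=> y z; rewrite innerBr.
- by rewrite ltr_wpDl// mulr_ge0.
- move=> y; apply: le_trans (inner_norm_le x y) _.
  by rewrite ler_wpM2r// lerDl.
Qed.

End InnerProduct.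

(** * Projections: additivity, continuity, null spaces *)

Section Projections.
Variables (R : realType) (A : cstarAlgType R) (H : hilbertModType A).
Implicit Types (P Q T a b : H -> H) (E : set H).

(** Moving [P] to the other argument reduces additivity of [P] to that of [inner]. *)
Lemma projectionB P : projection P -> {morph P : x y / x - y}.
Proof.
move=> [_ _ adjP] x y; apply: inner_inj => z.
by rewrite innerBl !adjP innerBl.
Qed.

Lemma projection_idem P x : projection P -> P (P x) = P x.
Proof. by case=> _ PP _; rewrite -[in RHS]PP. Qed.

Lemma projection0 P : projection P -> P 0 = 0.
Proof. by move=> projP; rewrite -[in LHS](subrr 0) projectionB// subrr. Qed.

Lemma projectionN P x : projection P -> P (- x) = - P x.
Proof.
by move=> projP; rewrite -[- x]sub0r projectionB// projection0// sub0r.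
Qed.

Lemma projectionD P : projection P -> {morph P : x y / x + y}.
Proof.
move=> projP x y; rewrite -[y in LHS]opprK projectionB//.
by rewrite (projectionN _ projP) opprK.
Qed.

Lemma projection_continuous P : projection P -> continuous P.
Proof.
move=> projP; apply: (@bounded_additive_continuous _ _ _ _ 4%:R) => //.
  exact: projectionB.
move=> x; have [->|Px0] := eqVneq (P x) 0; first by rewrite normr0 mulr_ge0.
have Pxp : 0 < `|P x| by rewrite normr_gt0.
have [_ _ adjP] := projP.
(* The squared norm of [P x] is the norm of [inner (P x) x], so one factor [|P x|] cancels. *)
rewrite -(ler_pM2r Pxp) -expr2 hnormE -/(inner _ _) adjP projection_idem//.
rewrite -adjP mulrAC; apply: le_trans (inner_norm_le _ _) _.
by [].
Qed.

Lemma mem_range_projection P x : projection P -> range P x <-> P x = x.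
Proof.
move=> projP; split=> [[y _ <-]|<-]; first exact: projection_idem.
by exists x.
Qed.

Lemma projection_compl P : projection P -> projection (idfun - P).
Proof.
move=> projP; have [_ PP adjP] := projP.
have adj : is_adjoint (idfun - P) (idfun - P).
  by move=> x y; rewrite /= !fctE innerBl innerBr adjP.
split=> //; first by exists (idfun - P).
apply/funext => x /=; rewrite !fctE /= projectionB//.
by rewrite projection_idem// subrr subr0.
Qed.

Lemma nullspace_compl P : projection P -> nullspace (idfun - P) = range P.
Proof.
move=> projP; apply/seteqP; split=> x; rewrite /nullspace /=.
  by move=> /eqP; rewrite subr_eq0 => /eqP xP; exists x.
by move=> /mem_range_projection -/(_ projP) Px; rewrite !fctE /= Px subrr.
Qed.

Lemma range_compl P : projection P -> range (idfun - P) = nullspace P.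
Proof.
move=> projP; rewrite -nullspace_compl; last exact: projection_compl.
by rewrite subKr.
Qed.

(* Positivity in [A] is not needed: if [a x + b x = 0] then
   <a x, a x> = <a x, x> = - <b x, x> = - <b x, b x> = - <a x, a x>. *)
Lemma nullspace_projD a b : projection a -> projection b ->
  nullspace (a + b) = nullspace a `&` nullspace b.
Proof.
move=> proja projb; have [_ _ adja] := proja; have [_ _ adjb] := projb.
apply/seteqP; split=> x; rewrite /nullspace /=; last first.
  by move=> [ax bx]; rewrite !fctE ax bx addr0.
rewrite !fctE => /eqP; rewrite addr_eq0 => /eqP abx.
suff bx : b x = 0 by rewrite abx bx oppr0.
have ea : inner (a x) x = inner (b x) (b x).
  by rewrite -(projection_idem x proja) adja abx innerNl innerNr opprK.
have eb : inner (b x) x = inner (b x) (b x).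
  by rewrite -(projection_idem x projb) adjb projection_idem.
move: ea; rewrite abx innerNl eb => /esym/eqP.
rewrite -subr_eq0 opprK -mulr2n -scaler_nat scaler_eq0 pnatr_eq0 /=.
by move=> /eqP/iprod_eq0.
Qed.

(** * Orthogonal complements and their projections *)

Lemma orthogonal_closure_range T : is_adjoint T T ->
  Defs.orthogonal (closure (range T)) = nullspace T.
Proof.
move=> adjT; apply/seteqP; split=> x; rewrite /Defs.orthogonal /nullspace /=.
  (* Pairing [x] with [T (T x)] gives [inner (T x) (T x) = 0]. *)
  move=> xT; apply: iprod_eq0; rewrite -/(inner _ _) adjT; apply: xT.
  by apply: subset_closure; exists (T x).
move=> Tx0 y yT.
move: y yT; rewrite closureE; apply: smallest_sub.
  exact: (closed_preimage0 (@continuous_inner _ _ _ x)).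
by move=> _ [z _ <-] /=; rewrite -adjT Tx0 inner0l.
Qed.

(** Existence has to be shown for [xget] to return a genuine projection: the component of [x]
    orthogonal to [E] provides one. *)
Lemma proj_onto_orthogonal E : orthocomplemented E ->
  projection (proj_onto (Defs.orthogonal E)) /\
  range (proj_onto (Defs.orthogonal E)) = Defs.orthogonal E.
Proof.
move=> compE.
apply: (xgetPex (0 : H -> H)
  (P := fun P => projection P /\ range P = Defs.orthogonal E)).
have /choice[p pP] : forall x, exists z, Defs.orthogonal E z /\
    exists2 y, E y & x = y + z.
  by move=> x; have [y [z [Ey Ez ->]]] := compE x; exists z; split => //; exists y.
have adjp : is_adjoint p p.
  move=> x x'; have [px [y Ey xE]] := pP x; have [px' [y' Ey' xE']] := pP x'.
  rewrite [in LHS]xE' [in RHS]xE innerDl innerDr px// add0r.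
  by rewrite (inner_eq0_sym (px' _ Ey)) add0r.
have fixp x : Defs.orthogonal E x -> p x = x.
  move=> ox; have [px [y Ey xE]] := pP x.
  rewrite [RHS]xE (_ : y = 0) ?add0r//; apply: iprod_eq0.
  have := ox _ Ey; rewrite [in X in inner X _]xE innerDl (px _ Ey) addr0.
  by [].
exists p; split; first split=> //; first by exists p.
  by apply/funext => x /=; apply: fixp; have [] := pP x.
apply/seteqP; split=> [_ [x _ <-]|x ox]; first by have [] := pP x.
by exists x => //; exact: fixp.
Qed.

Lemma orthogonalK E : orthocomplemented E ->
  Defs.orthogonal (Defs.orthogonal E) `<=` E.
Proof.
move=> compE x oox; have [y [z [Ey oz xE]]] := compE x.
suff z0 : z = 0 by rewrite xE z0 addr0.
apply: iprod_eq0; have := oox _ oz; rewrite xE innerDl.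
by rewrite (inner_eq0_sym (oz _ Ey)) add0r.
Qed.

(** The form in which harmony is used: vectors orthogonal to [M] are limits of values of [a + b]. *)
Lemma nullspaceI_complemented a b : projection a -> projection b ->
    orthocomplemented (closure (range (a + b))) ->
  let M := nullspace a `&` nullspace b in
  [/\ projection (proj_onto M), range (proj_onto M) = M &
      Defs.orthogonal M `<=` closure (range (a + b))].
Proof.
move=> proja projb compE M.
have -> : M = Defs.orthogonal (closure (range (a + b))).
  rewrite orthogonal_closure_range ?nullspace_projD//.
  have [_ _ adja] := proja; have [_ _ adjb] := projb.
  by move=> x y; rewrite !fctE innerDl innerDr adja adjb.
have [? ?] := proj_onto_orthogonal compE.
by split=> //; exact: orthogonalK.
Qed.

(** The two hypotheses concern the sums whose null spaces are [H1] and [H2]; the four conditions of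
    harmony supply them for [(P, Q)] and for [(I-P, Q)]. *)
Lemma closure_range_P5 P Q : projection P -> projection Q ->
    orthocomplemented (closure (range ((idfun - P) + (idfun - Q)))) ->
    orthocomplemented (closure (range ((idfun - P) + Q))) ->
  closure (range (P5 P Q \o Q)) = H5 P Q /\
  closure (range (Q \o P5 P Q)) = closure (range (Q \o P \o (idfun - Q))).
Proof.
move=> projP projQ compl1 compl2.
have projP' := projection_compl projP; have projQ' := projection_compl projQ.
have [_ _ adjP] := projP; have [_ _ adjQ] := projQ.
have := nullspaceI_complemented projP' projQ' compl1.
rewrite !nullspace_compl//= -/(H1 P Q) -/(P1 P Q) => -[projP1 rP1 H1o].
have := nullspaceI_complemented projP' projQ compl2.
rewrite nullspace_compl//= -/(H2 P Q) -/(P2 P Q) => -[projP2 rP2 H2o].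
have [_ _ adjP1] := projP1; have [_ _ adjP2] := projP2.
have P5E x : P5 P Q x = P x - P1 P Q x - P2 P Q x by [].
have [PP1 QP1] : (forall x, P (P1 P Q x) = P1 P Q x) /\
    (forall x, Q (P1 P Q x) = P1 P Q x).
  by split=> x; apply/mem_range_projection => //;
    have [] : H1 P Q (P1 P Q x) by rewrite -rP1; exists x.
have [PP2 QP2] : (forall x, P (P2 P Q x) = P2 P Q x) /\
    (forall x, Q (P2 P Q x) = 0).
  split=> x; have [] : H2 P Q (P2 P Q x) by rewrite -rP2; exists x.
    by move=> /mem_range_projection ->.
  by [].
(* Adjoints of the identities just proved: [P P1 = P1] gives [P1 P = P1], and [Q P2 = 0] gives
   [P2 Q = 0]. *)
have P1P x : P1 P Q (P x) = P1 P Q x.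
  by apply: inner_inj => z; rewrite !(adjP1, adjP) PP1.
have P2P x : P2 P Q (P x) = P2 P Q x.
  by apply: inner_inj => z; rewrite !(adjP2, adjP) PP2.
have P1Q x : P1 P Q (Q x) = P1 P Q x.
  by apply: inner_inj => z; rewrite !(adjP1, adjQ) QP1.
have P2Q x : P2 P Q (Q x) = 0.
  by apply: inner_inj => z; rewrite adjP2 adjQ QP2 inner0l inner0r.
have P5P x : P5 P Q (P x) = P5 P Q x.
  by rewrite !P5E projection_idem// P1P P2P.
have adjP5 : is_adjoint (P5 P Q) (P5 P Q).
  by move=> x y; rewrite !P5E !innerBl !innerBr adjP adjP1 adjP2.
have P5B x y : P5 P Q (x - y) = P5 P Q x - P5 P Q y.
  by apply: inner_inj => z; rewrite innerBl !adjP5 innerBl.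
(* [P1] and [P2] annihilate each other: [P2 P1 = P2 Q P1 = 0] and [P1 P2 = P1 Q P2 = 0]. *)
have P5_H1 h : H1 P Q h -> P5 P Q h = 0.
  rewrite -rP1 => -[x _ <-]; rewrite P5E PP1 projection_idem// subrr sub0r.
  by rewrite -QP1 P2Q oppr0.
have P5_H2 h : H2 P Q h -> P5 P Q h = 0.
  rewrite -rP2 => -[x _ <-]; rewrite P5E PP2 projection_idem//.
  by rewrite addrAC subrr sub0r -P1Q QP2 projection0// oppr0.
have P5H1 x : Defs.orthogonal (H1 P Q) (P5 P Q x).
  by move=> h /P5_H1 h0; rewrite adjP5 h0 inner0r.
have P5H2 x : Defs.orthogonal (H2 P Q) (P5 P Q x).
  by move=> h /P5_H2 h0; rewrite adjP5 h0 inner0r.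
have P5_idem x : P5 P Q (P5 P Q x) = P5 P Q x.
  rewrite [in LHS](P5E x) !P5B P5P (P5_H1 (P1 P Q x)) ?(P5_H2 (P2 P Q x)) ?subr0//.
    by rewrite -rP2; exists x.
  by rewrite -rP1; exists x.
have projP5 : projection (P5 P Q).
  by split=> //; [exists (P5 P Q)|apply/funext => x /=].
have cP5 := projection_continuous projP5.
have P5P' x : P5 P Q (x - P x) = 0 by rewrite P5B P5P subrr.
(* The corrections vanish because [P1 (I-Q) = 0] and [Q P2 = 0]. *)
have QP5Q' x : Q (P5 P Q (x - Q x)) = Q (P (x - Q x)).
  rewrite P5E [P1 P Q (_ - _)]projectionB// P1Q subrr subr0.
  by rewrite [LHS]projectionB// QP2 subr0.
split; apply/seteqP; split.
(* [H5] is closed, being the null space of [I - P5]. *)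
- suff cl : closed (H5 P Q).
    rewrite closureE; apply: smallest_sub => // _ [x _ <-].
    by exists (Q x).
  rewrite /H5 -nullspace_compl//.
  exact: (closed_preimage0 (projection_continuous (projection_compl projP5))).
(* The outer [P5] is applied to approximants [(I-P) z + Q z] of the inner [P5 x]. *)
- move=> _ [x _ <-]; rewrite -P5_idem.
  move: (P5 P Q x) (H2o _ (P5H2 x)); apply: closure_sub_preimage => //.
  move=> _ [z _ <-]; exists z => //.
  by rewrite /= !fctE /= (projectionD projP5) P5P' add0r.
- rewrite [X in X `<=` _]closureE; apply: smallest_sub.
    exact: closed_closure.
  move=> _ [x _ <-] /=; rewrite -P5_idem.
  move: (P5 P Q x) (H1o _ (P5H1 x)).
  apply: (@closure_sub_preimage _ _ (Q \o P5 P Q)).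
    by move=> ?; apply: continuous_comp; [exact: cP5|
      exact: projection_continuous].
  move=> _ [z _ <-]; exists z => //.
  by rewrite /= !fctE /= (projectionD projP5) P5P' add0r QP5Q'.
- apply: closureS => _ [x _ <-]; exists (x - Q x) => //.
Qed.

End Projections.

Theorem lemma4p4 (R : realType) (A : cstarAlgType R) (H : hilbertModType A)
    (P Q : H -> H) (projP : projection P) (projQ : projection Q)
    (harmPQ : harmonious P Q) :
  [/\ closure (range (P5 P Q \o Q)) = H5 P Q,
      closure (range (Q \o P5 P Q)) = closure (range (Q \o P \o (idfun - Q))),
      closure (range (P6 P Q \o Q)) = H6 P Q &
      closure (range (Q \o P6 P Q)) = closure (range (Q \o P \o (idfun - Q)))].
Proof.
have [cPQ cPQ' cP'Q cP'Q'] := harmPQ.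
rewrite -addrA in cP'Q'; rewrite -addrA in cPQ'.
have projP' := projection_compl projP.
(* Replacing [P] by [I-P] turns [H1] and [H2] into [H3] and [H4]. *)
have P6E : P6 P Q = P5 (idfun - P) Q.
  by rewrite /P6 /P5 /P3 /P4 /P1 /P2 /H1 /H2 range_compl.
have [-> ->] := closure_range_P5 projP projQ cP'Q' cP'Q.
have [] := @closure_range_P5 _ _ _ (idfun - P) Q projP' projQ.
- by rewrite subKr.
- by rewrite subKr.
rewrite /H6 P6E => -> ->; split=> //; congr closure.
have E x : Q ((idfun - P) (x - Q x)) = - Q (P (x - Q x)).
  rewrite (projectionB projQ (x - Q x)) [Q (x - Q x)]projectionB//.
  by rewrite projection_idem// subrr sub0r.
have N x : Q (P (- x - Q (- x))) = - Q (P (x - Q x)).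
  by rewrite (projectionN _ projQ) -opprD (projectionN _ projP) projectionN.
(* The sign is absorbed by the substitution of [- x] for [x]. *)
apply/seteqP; split=> _ [x _ <-]; exists (- x) => //.
  by rewrite /= E !fctE /= N.
by rewrite /= E !fctE /= N opprK.
Qed.
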